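(* Let $q$ be a $\phi$-$\delta$-primary element of $L$. If $\phi(q)$ is a $\delta$-primary element of $L$, then $q$ is $\delta$-primary.
   Context: A multiplicative lattice is a complete lattice (least element $0$, greatest element $1$) with a commutative, associative multiplication that distributes over arbitrary joins and for which $1$ is the identity. An element $a$ is compact if $a\leqslant \bigvee X$ with $X\subseteq L$ implies $a\leqslant a_1\vee\dots\vee a_n$ for finitely many $a_i\in X$; $L$ is compactly generated if every element is a join of compact elements. Standing assumptions: $L$ is a compactly generated multiplicative lattice in which $1$ is compact and every finite product of compact elements is compact; $\delta:L\to L$ is an expansion function, i.e. $a\leqslant\delta(a)$ for all $a$, and $a\leqslant b$ implies $\delta(a)\leqslant\delta(b)$; $\phi:L\to L$ is a function with $\phi(a)\leqslant a$ for all $a$. An element $p$ is proper if $p<1$. A proper element $p$ is $\delta$-primary if for all $a,b\in L$, $ab\leqslant p$ implies $a\leqslant p$ or $b\leqslant\delta(p)$; it is $\phi$-$\delta$-primary if for all $a,b\in L$, $ab\leqslant p$ and $ab\not\leqslant\phi(p)$ implies $a\leqslant p$ or $b\leqslant\delta(p)$. *)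

(* Defs.v *)
From HB Require Import structures.
From mathcomp Require Import all_boot all_order.
From mathcomp Require Import boolp classical_sets.

Set Implicit Arguments.
Unset Strict Implicit.
Unset Printing Implicit Defensive.

Import Order.TTheory.

Local Open Scope classical_set_scope.
Local Open Scope order_scope.

(* [\bot] is the default value of [supremum], i.e., its value on [set0], so
   that this is the join of [X] whenever [X] has a least upper bound. *)
Definition sup_of d (L : bPOrderType d) (X : set L) : L := supremum \bot X.

HB.mixin Record TBLattice_isMultLattice d L of Order.TBLattice d L := {
  supremums_neq0 : forall X : set L, supremums X !=set0;
  infimums_neq0 : forall X : set L, infimums X !=set0;
  lmul : L -> L -> L;
  lmulA : associative lmul;
  lmulC : commutative lmul;
  lmul1x : left_id \top lmul;
  lmul_sup : forall (a : L) (X : set L),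
    lmul a (sup_of X) = sup_of [set lmul a x | x in X]
}.

#[short(type="multLatticeType")]
HB.structure Definition MultLattice d :=
  { L of TBLattice_isMultLattice d L & Order.TBLattice d L }.

Notation "a ** b" := (lmul a b) (at level 40, left associativity) : order_scope.

Section MultLattice.
Context d (L : multLatticeType d).
Implicit Types (a b p : L) (X : set L).

Definition compact_elt a :=
  forall X, a <= sup_of X ->
    exists s : seq L, [set` s] `<=` X /\ a <= \join_(x <- s) x.

Definition compactly_generated :=
  forall a, exists X, X `<=` [set x | compact_elt x] /\ a = sup_of X.

Definition compact_prod_closed :=
  forall s : seq L, (forall x, x \in s -> compact_elt x) ->
    compact_elt (\big[lmul / \top]_(x <- s) x).

Definition expansion_function (delta : L -> L) :=
  (forall a, a <= delta a) /\ (forall a b, a <= b -> delta a <= delta b).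

Definition proper_elt p := p < \top.

Definition delta_primary (delta : L -> L) p :=
  proper_elt p /\
  forall a b, a ** b <= p -> a <= p \/ b <= delta p.

Definition phi_delta_primary (phi delta : L -> L) p :=
  proper_elt p /\
  forall a b, a ** b <= p -> ~ (a ** b <= phi p) -> a <= p \/ b <= delta p.

End MultLattice.

Arguments compactly_generated {d} L.
Arguments compact_prod_closed {d} L.

(* Main.v *)
Require Import Defs.
From mathcomp Require Import all_boot all_order.

Local Open Scope order_scope.

Theorem theorem2p35 (d : Order.disp_t) (L : multLatticeType d)
    (L_cg : compactly_generated L)
    (top_compact : compact_elt (\top : L))
    (compact_prod : compact_prod_closed L)
    (delta : L -> L) (delta_exp : expansion_function delta)
    (phi : L -> L) (phi_le : forall a : L, phi a <= a)
    (q : L) (q_primary : phi_delta_primary phi delta q)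
    (phiq_primary : delta_primary delta (phi q)) :
  delta_primary delta q.
Proof.
have [_ delta_mono] := delta_exp.
have [q_proper q_prim] := q_primary; have [_ phiq_prim] := phiq_primary.
split=> // a b ab_q.
(* Below [phi q] the condition on [q] is void, but there primariness of [phi q]
   decides, and its conclusion passes up to [q] because [phi q <= q]. *)
have [ab_phiq | /negP ab_nphiq] := boolP (a ** b <= phi q); last exact: q_prim.
have [a_phiq | b_dphiq] := phiq_prim a b ab_phiq.
- by left; apply: Order.POrderTheory.le_trans (phi_le q).
- right; apply: Order.POrderTheory.le_trans b_dphiq _.
  exact: delta_mono (phi_le q).
Qed.
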